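(* The pair $(\rightleftarrows, \mathrm{rev})$ satisfies the pointlike transfer condition. That is, $$\mathrm{PL}_{\mathbf{V}^{\mathrm{rev}}}(S) = \big( \mathrm{PL}_{\mathbf{V}}(S^{\mathrm{rev}}) \big)^{\mathrm{rev}}$$ for any pseudovariety $\mathbf{V}$ and any finite semigroup $S$.
   Context: $\mathsf{FSgp}$ is the category of finite semigroups (the empty semigroup is allowed) and homomorphisms. For a finite semigroup $S$, $\mathcal{P}(S)$ is the semigroup of non-empty subsets of $S$ under $XY = \{xy : x\in X, y\in Y\}$, and $\mathrm{sing}(S)$ is its subsemigroup of singletons. A homomorphism $\varphi : S \to T$ extends to $\dot\varphi : \mathcal{P}(S) \to \mathcal{P}(T)$, $X \mapsto \{\varphi(x) : x \in X\}$. An $S$-complex is a subsemigroup of $\mathcal{P}(S)$ which contains $\mathrm{sing}(S)$ and is closed under taking non-empty subsets of its members. A complex functor is a functor $\mathcal{C} : \mathsf{FSgp} \to \mathsf{FSgp}$ such that $\mathcal{C}(S)$ is an $S$-complex for every $S$, $\mathcal{C}(\varphi)$ is the restriction $\dot\varphi : \mathcal{C}(S) \to \mathcal{C}(T)$ for each $\varphi : S\to T$, and $\mathcal{C}$ preserves surjective homomorphisms. $\mathbf{CF}$ is the complete lattice of complex functors ordered by pointwise inclusion. $\mathrm{Fix}(\mathcal{C}) = \{ S : \mathcal{C}(S) = \mathrm{sing}(S) \}$. A pseudovariety is a class of finite semigroups closed under subsemigroups, homomorphic images and finite products; $\mathbf{PV}$ is the complete lattice of pseudovarieties under inclusion. A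 relational morphism $\rho$ from $S$ to $T$ is determined by its graph $\Gamma(S,\rho,T)$, a subsemigroup of $S \times T$ projecting onto $S$; for $t\in T$, $\rho^{-1}(t) = \{ s : (s,t) \in \Gamma(S,\rho,T)\}$; the nerve is $\mathrm{Nrv}(S,\rho,T) = \{ X \in \mathcal{P}(S) : X \subseteq \rho^{-1}(t) \text{ for some } t \in T \}$. $\mathrm{PL}_{\mathbf{V}} \in \mathbf{CF}$ is given by $\mathrm{PL}_{\mathbf{V}}(S) = \bigcap \mathrm{Nrv}(S,\rho,V)$ over all relational morphisms $\rho$ from $S$ to some $V\in\mathbf{V}$. The reversal $S^{\mathrm{rev}}$ of a finite semigroup $S$ has the same underlying set as $S$ and operation $x \cdot^{\mathrm{rev}} y = yx$. For a pseudovariety $\mathbf{V}$, $\mathbf{V}^{\mathrm{rev}} = \{V^{\mathrm{rev}} : V \in \mathbf{V}\}$; this defines an operator $\mathrm{rev} : \mathbf{PV} \to \mathbf{PV}$. The operator $\rightleftarrows : \mathbf{CF} \to \mathbf{CF}$ is given by $\mathcal{C}^{\rightleftarrows}(S) = (\mathcal{C}(S^{\mathrm{rev}}))^{\mathrm{rev}}$. A monotone operator $\lambda$ on $\mathbf{CF}$ is algebraic if $\mathrm{Fix}(\mathcal{C}_1)=\mathrm{Fix}(\mathcal{C}_2)$ implies $\mathrm{Fix}(\lambda(\mathcal{C}_1))=\mathrm{Fix}(\lambda(\mathcal{C}_2))$; an operator on $\mathbf{PV}$ is continuous if it is monotone and preserves directed joins. For $\lambda$ algebraic and $\alpha$ continuous,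 the pair $(\lambda,\alpha)$ satisfies the pointlike transfer condition if $\lambda(\mathrm{PL}_{\mathbf{V}}) = \mathrm{PL}_{\alpha(\mathbf{V})}$ for every pseudovariety $\mathbf{V}$. *)

(* Defs.v *)
From HB Require Import structures.
From mathcomp Require Import all_boot.
From mathcomp Require Import boolp.

Set Implicit Arguments.
Unset Strict Implicit.
Unset Printing Implicit Defensive.

Local Open Scope group_scope.

(* An object may have an empty carrier.  Morphisms are the library's           *)
(* {multiplicative S -> T}.                                                    *)
#[short(type="finSemigroupType")]
HB.structure Definition FinSemigroup := {S of Semigroup S & Finite S}.

HB.instance Definition _ (S T : finSemigroupType) := Semigroup.on (S * T)%type.

Definition unit_mul (x y : unit) : unit := tt.
Fact unit_mulA : associative unit_mul. Proof. by []. Qed.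
HB.instance Definition _ := isSemigroup.Build unit unit_mulA.

Definition surj (S T : Type) (f : S -> T) := forall y, exists x, f x = y.

Record subsg (S : finSemigroupType) := Subsg {
  subsg_set :> {set S};
  subsg_closed : mulg_closed subsg_set
}.

Definition subsg_of (S : finSemigroupType) (A : subsg S) : Type :=
  {x : S | x \in subsg_set A}.
HB.instance Definition _ S (A : subsg S) :=
  [isSub of subsg_of A for (@proj1_sig _ _ : subsg_of A -> S)].
HB.instance Definition _ S (A : subsg S) := [Finite of subsg_of A by <:].
HB.instance Definition _ S (A : subsg S) :=
  SubChoice_isSubSemigroup.Build S (fun x => x \in subsg_set A)
    (subsg_of A) (@subsg_closed S A).

Definition powersg (S : finSemigroupType) : Type := {X : {set S} | X != set0}.
HB.instance Definition _ S :=
  [isSub of powersg S for (@proj1_sig _ _ : powersg S -> {set S})].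
HB.instance Definition _ S := [Finite of powersg S by <:].

Definition Powersg (S : finSemigroupType) (X : {set S}) (X0 : X != set0) :
  powersg S := exist (fun X => X != set0) X X0.

Section PowerSemigroup.
Variable S : finSemigroupType.
Implicit Types X Y Z : powersg S.

Fact powersg_mul_subproof X Y : [set x * y | x in val X, y in val Y] != set0.
Proof.
case: X Y => [X /= /set0Pn[x xX]] [Y /= /set0Pn[y yY]].
by apply/set0Pn; exists (x * y); apply: imset2_f.
Qed.

Definition powersg_mul X Y : powersg S := Powersg (powersg_mul_subproof X Y).

Fact powersg_mulA : associative powersg_mul.
Proof.
move=> X Y Z; apply: val_inj => /=; apply/setP => w; apply/imset2P/imset2P.
  case=> x _ xX /imset2P[y z yY zZ ->] ->.
  by exists (x * y) z; rewrite ?mulgA //; apply: imset2_f.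
case=> _ z /imset2P[x y xX yY ->] zZ ->.
by exists x (y * z); rewrite -?mulgA //; apply: imset2_f.
Qed.

HB.instance Definition _ := isSemigroup.Build (powersg S) powersg_mulA.

Fact singP (x : S) : [set x] != set0.
Proof. by apply/set0Pn; exists x; rewrite inE. Qed.

Definition sing : {set powersg S} :=
  [set Powersg (singP x) | x : S].

End PowerSemigroup.

Fact powersg_map_subproof (S T : finSemigroupType) (f : S -> T)
  (X : powersg S) : f @: val X != set0.
Proof.
case: X => X /= /set0Pn[x xX].
by apply/set0Pn; exists (f x); apply: imset_f.
Qed.

Definition powersg_map (S T : finSemigroupType) (f : S -> T) (X : powersg S) :
  powersg T := Powersg (powersg_map_subproof f X).

Definition is_complex (S : finSemigroupType) (A : subsg (powersg S)) :=
  sing S \subset A /\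
  forall X Y : powersg S, X \in A -> val Y \subset val X -> Y \in A.

(* The action on morphisms is forced to be restriction of powersg_map, so the  *)
(* only data is the object map; see cf_mor below for the action on morphisms.  *)
Record complex_functor := ComplexFunctor {
  cf_obj :> forall S : finSemigroupType, subsg (powersg S);
  cf_complex : forall S, is_complex (cf_obj S);
  cf_map : forall (S T : finSemigroupType) (f : {multiplicative S -> T})
    (X : powersg S), X \in cf_obj S -> powersg_map f X \in cf_obj T;
  cf_surj : forall (S T : finSemigroupType) (f : {multiplicative S -> T}),
    surj f -> forall Y : powersg T, Y \in cf_obj T ->
    exists2 X : powersg S, X \in cf_obj S & powersg_map f X = Y
}.

Section ComplexFunctorMorphisms.
Variables (C : complex_functor).

Definition cf_mor (S T : finSemigroupType) (f : {multiplicative S -> T})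
    (X : subsg_of (C S)) : subsg_of (C T) :=
  Sub (powersg_map f (val X)) (cf_map f (valP X)).

Lemma powersg_mapM (S T : finSemigroupType) (f : {multiplicative S -> T}) :
  {morph powersg_map f : X Y / X * Y}.
Proof.
move=> X Y; apply: val_inj; apply/setP => t; apply/imsetP/imset2P => /=.
  case=> _ /imset2P[x y xX yY ->] ->; rewrite gmulfM.
  by exists (f x) (f y) => //; apply: imset_f.
case=> _ _ /imsetP[x xX ->] /imsetP[y yY ->] ->; rewrite -gmulfM.
by exists (x * y) => //; apply: imset2_f.
Qed.

Fact cf_mor_mul (S T : finSemigroupType) (f : {multiplicative S -> T}) : {morph cf_mor f : X Y / X * Y}.
Proof.
by move=> X Y; apply: val_inj; apply: powersg_mapM.
Qed.

HB.instance Definition _ (S T : finSemigroupType) (f : {multiplicative S -> T}) :=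
  isMultiplicative.Build (subsg_of (C S)) (subsg_of (C T)) (cf_mor f)
    (cf_mor_mul f).

Lemma cf_mor_id S : @cf_mor S S idfun =1 id.
Proof. by move=> X; do 2!apply: val_inj; rewrite /= imset_id. Qed.

Lemma cf_mor_comp (S T U : finSemigroupType) (g : {multiplicative T -> U}) (f : {multiplicative S -> T}) :
  @cf_mor S U (g \o f) =1 cf_mor g \o cf_mor f.
Proof. by move=> X; do 2!apply: val_inj; rewrite /= imset_comp. Qed.

Lemma cf_mor_surj (S T : finSemigroupType) (f : {multiplicative S -> T}) : surj f -> surj (cf_mor f).
Proof.
move=> fs [Y YC]; have [X XC XY] := cf_surj fs YC.
by exists (Sub X XC); apply: val_inj.
Qed.

End ComplexFunctorMorphisms.

Definition cf_le (C D : complex_functor) := forall S, C S \subset D S.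

Definition Fix (C : complex_functor) (S : finSemigroupType) : Prop :=
  C S = sing S :> {set _}.

(* pv_unit is closure under the empty product.                                 *)
Record pseudovariety := Pseudovariety {
  pv_mem :> finSemigroupType -> Prop;
  pv_sub : forall (S : finSemigroupType) (A : subsg S),
    pv_mem S -> pv_mem (subsg_of A);
  pv_img : forall (S T : finSemigroupType) (f : {multiplicative S -> T}),
    surj f -> pv_mem S -> pv_mem T;
  pv_unit : pv_mem unit;
  pv_prod : forall S T : finSemigroupType,
    pv_mem S -> pv_mem T -> pv_mem (S * T)%type
}.

Definition pv_le (V W : pseudovariety) := forall S, V S -> W S.

Section PvJoin.
Variable D : pseudovariety -> Prop.

Definition pv_join_mem (S : finSemigroupType) : Prop :=
  forall W : pseudovariety, (forall V, D V -> pv_le V W) -> W S.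

Fact pv_join_sub (S : finSemigroupType) (A : subsg S) :
  pv_join_mem S -> pv_join_mem (subsg_of A).
Proof. by move=> h W hW; exact: (pv_sub A (h W hW)). Qed.

Fact pv_join_img (S T : finSemigroupType) (f : {multiplicative S -> T}) :
  surj f -> pv_join_mem S -> pv_join_mem T.
Proof. by move=> fs h W hW; exact: (pv_img fs (h W hW)). Qed.

Fact pv_join_unit : pv_join_mem unit.
Proof. by move=> W hW; exact: pv_unit. Qed.

Fact pv_join_prod (S T : finSemigroupType) :
  pv_join_mem S -> pv_join_mem T -> pv_join_mem (S * T)%type.
Proof. by move=> h1 h2 W hW; exact: (pv_prod (h1 W hW) (h2 W hW)). Qed.

Definition pv_join : pseudovariety :=
  Pseudovariety pv_join_sub pv_join_img pv_join_unit pv_join_prod.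

Lemma pv_join_ub V : D V -> pv_le V pv_join.
Proof. by move=> DV S VS W hW; exact: (hW V DV). Qed.

Lemma pv_join_lub W : (forall V, D V -> pv_le V W) -> pv_le pv_join W.
Proof. by move=> hW S hS; exact: (hS W hW). Qed.

End PvJoin.

Definition pv_directed (D : pseudovariety -> Prop) :=
  (exists V, D V) /\
  forall V W, D V -> D W -> exists U, [/\ D U, pv_le V U & pv_le W U].

Definition pv_continuous (alpha : pseudovariety -> pseudovariety) :=
  (forall V W, pv_le V W -> pv_le (alpha V) (alpha W)) /\
  forall D, pv_directed D ->
    alpha (pv_join D) = pv_join (fun W => exists2 V, D V & W = alpha V).

Record relmor (S T : finSemigroupType) := Relmor {
  graph :> subsg (S * T)%type;
  graph_proj : forall s : S, exists t : T, (s, t) \in graph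
}.

Definition relmor_preim S T (rho : relmor S T) (t : T) : {set S} :=
  [set s | (s, t) \in rho].

Definition nerve S T (rho : relmor S T) : {set powersg S} :=
  [set X : powersg S | [exists t, val X \subset relmor_preim rho t]].

Lemma nerveP S T (rho : relmor S T) (X : powersg S) :
  reflect (exists t, forall s, s \in val X -> (s, t) \in rho)
          (X \in nerve rho).
Proof.
rewrite inE; apply: (iffP existsP) => -[t h]; exists t.
  by move=> s /(subsetP h); rewrite inE.
by apply/subsetP => s /h; rewrite inE.
Qed.

Section Pointlikes.
Variable V : pseudovariety.

Definition PL_set (S : finSemigroupType) : {set powersg S} :=
  [set X : powersg S |
    `[< forall (T : finSemigroupType) (rho : relmor S T),
          V T -> X \in nerve rho >]].

Lemma PL_setP (S : finSemigroupType) (X : powersg S) :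
  reflect (forall (T : finSemigroupType) (rho : relmor S T),
             V T -> X \in nerve rho) (X \in PL_set S).
Proof. by rewrite inE; apply: asboolP. Qed.

Fact PL_closed S : mulg_closed (PL_set S).
Proof.
move=> X Y /PL_setP hX /PL_setP hY; apply/PL_setP => T rho VT.
have /nerveP[t ht] := hX T rho VT; have /nerveP[u hu] := hY T rho VT.
apply/nerveP; exists (t * u) => _ /imset2P[x y xX yY ->].
exact: (subsg_closed (ht _ xX) (hu _ yY)).
Qed.

Definition PL_obj S : subsg (powersg S) := Subsg (@PL_closed S).

Fact PL_complex S : is_complex (PL_obj S).
Proof.
split.
  apply/subsetP => _ /imsetP[x _ ->]; apply/PL_setP => T rho VT.
  have [t xt] := graph_proj rho x.
  by apply/nerveP; exists t => s /set1P ->.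
move=> X Y /PL_setP hX /subsetP YX; apply/PL_setP => T rho VT.
have /nerveP[t ht] := hX T rho VT.
by apply/nerveP; exists t => s /YX /ht.
Qed.

Fact PL_map (S T : finSemigroupType) (f : {multiplicative S -> T})
  (X : powersg S) : X \in PL_obj S -> powersg_map f X \in PL_obj T.
Proof.
move=> /PL_setP hX; apply/PL_setP => U rho VU.
pose G := [set p : S * U | (f p.1, p.2) \in rho].
have Gc : mulg_closed G.
  move=> [a u] [b v]; rewrite !inE /= => h1 h2.
  by rewrite gmulfM; apply: (subsg_closed h1 h2).
have Gp s : exists t : U, (s, t) \in Subsg Gc.
  by have [t h] := graph_proj rho (f s); exists t; rewrite inE.
have /nerveP[t ht] := hX U (Relmor Gp) VU.
apply/nerveP; exists t => _ /imsetP[s sX ->].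
by have := ht _ sX; rewrite inE.
Qed.

Lemma PL_single S : exists (T : finSemigroupType) (rho : relmor S T),
  V T /\ nerve rho \subset PL_set S.
Proof.
suff [T [rho [VT h]]] : exists (T : finSemigroupType) (rho : relmor S T),
    V T /\ forall X, X \in enum {: powersg S} -> X \in nerve rho -> X \in PL_set S.
  by exists T, rho; split=> //; apply/subsetP => X; apply: h; rewrite mem_enum.
elim: (enum _) => [|Y s [T [rho [VT h]]]].
  have Gc : mulg_closed (setT : {set S * unit}) by move=> ? ? *; rewrite inE.
  have Gp s : exists t : unit, (s, t) \in Subsg Gc by exists tt; rewrite inE.
  by exists unit, (Relmor Gp); split; [exact: pv_unit|].
have [YP|/PL_setP nYP] := boolP (Y \in PL_set S).
  by exists T, rho; split=> // X; rewrite inE => /orP[/eqP-> //|]; apply: h.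
have [U [sg [VU nY]]] : exists (U : finSemigroupType) (sg : relmor S U),
    V U /\ Y \notin nerve sg.
  apply: contrapT => hn; apply: nYP => U sg VU.
  by apply/negPn/negP => hY; apply: hn; exists U, sg.
pose G := [set p : S * (T * U) |
  ((p.1, p.2.1) \in rho) && ((p.1, p.2.2) \in sg)].
have Gc : mulg_closed G.
  move=> [a [t u]] [b [t' u']]; rewrite !inE /= => /andP[h1 h2] /andP[h3 h4].
  by apply/andP; split; [apply: (subsg_closed h1 h3) | apply: (subsg_closed h2 h4)].
have Gp x : exists t : (T * U)%type, (x, t) \in Subsg Gc.
  have [t ht] := graph_proj rho x; have [u hu] := graph_proj sg x.
  by exists (t, u); rewrite inE /= ht hu.
exists (T * U)%type, (Relmor Gp); split; first exact: pv_prod.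
move=> X; rewrite inE => /orP[/eqP -> /nerveP[[t u] hY]|Xs /nerveP[[t u] hX]].
  case/negP: nY; apply/nerveP; exists u => x /hY.
  by rewrite inE => /andP[].
apply: h Xs _; apply/nerveP; exists t => x /hX.
by rewrite inE => /andP[].
Qed.

Fact PL_surj (S T : finSemigroupType) (f : {multiplicative S -> T}) :
  surj f -> forall Y : powersg T, Y \in PL_obj T ->
  exists2 X : powersg S, X \in PL_obj S & powersg_map f X = Y.
Proof.
move=> fs Y /PL_setP hY; have [U [rho [VU /subsetP sub]]] := PL_single S.
pose G := [set (f p.1, p.2) | p in subsg_set rho].
have Gc : mulg_closed G.
  move=> _ _ /imsetP[[a u] h1 ->] /imsetP[[b v] h2 ->] /=.
  apply/imsetP; exists (a * b, u * v); first exact: (subsg_closed h1 h2).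
  by rewrite /= gmulfM.
have Gp t : exists u : U, (t, u) \in Subsg Gc.
  have [s <-] := fs t; have [u su] := graph_proj rho s.
  by exists u; apply/imsetP; exists (s, u).
have /nerveP[u hu] := hY U (Relmor Gp) VU.
pose X := [set s | (f s \in val Y) && ((s, u) \in rho)].
have lift t : t \in val Y -> exists2 s, s \in X & f s = t.
  move=> tY; have /imsetP[[s v] srho [tE vE]] := hu t tY.
  by exists s => //; rewrite inE -tE tY vE.
have X0 : X != set0.
  have /set0Pn[t /lift[s sX _]] := valP Y.
  by apply/set0Pn; exists s.
exists (Powersg X0).
  by apply: sub; apply/nerveP; exists u => s; rewrite /= inE => /andP[].
apply: val_inj; apply/setP => t; apply/imsetP/idP => /=.
  by case=> s; rewrite inE => /andP[h _] ->.
by move=> /lift[s sX <-]; exists s.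
Qed.

Definition PL : complex_functor := ComplexFunctor PL_complex PL_map PL_surj.

End Pointlikes.

Definition revsg (S : Type) : Type := S.

Section Reversal.
Variable S : finSemigroupType.

HB.instance Definition _ := Finite.copy (revsg S) S.

Definition revsg_mul (x y : revsg S) : revsg S := (y : S) * (x : S).

Fact revsg_mulA : associative revsg_mul.
Proof. by move=> x y z; rewrite /revsg_mul mulgA. Qed.

HB.instance Definition _ := isSemigroup.Build (revsg S) revsg_mulA.

End Reversal.

Lemma revsgK (S : finSemigroupType) : revsg (revsg S) = S :> finSemigroupType.
Proof.
case: S => s [[m] [a] c e [k u] [p q]].
pose dE := hasDecEq.Axioms_ k u.
pose P (a' : associative m) : finSemigroupType :=
  FinSemigroup.Pack (@FinSemigroup.Class s (hasMul.Axioms_ m)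
    (Magma_isSemigroup.Axioms_ (local_mixin_monoid_hasMul := hasMul.Axioms_ m) a')
    c e dE (isFinite.Axioms_ (local_mixin_eqtype_hasDecEq := dE) p q)).
exact: (congr1 P (Prop_irrelevance (@mulgA (revsg (revsg (P a)))) a)).
Qed.

Definition revmor (S T : finSemigroupType) (f : S -> T) : revsg S -> revsg T := f.

Fact revmor_mul (S T : finSemigroupType) (f : {multiplicative S -> T}) :
  {morph revmor f : x y / x * y}.
Proof. move=> x y; exact: (@gmulfM S T f (y : S) (x : S)). Qed.

HB.instance Definition _ (S T : finSemigroupType) (f : {multiplicative S -> T}) :=
  isMultiplicative.Build (revsg S) (revsg T) (revmor f) (revmor_mul f).

Section PvRev.
Variable V : pseudovariety.

Definition pv_rev_mem (S : finSemigroupType) : Prop :=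
  exists2 W : finSemigroupType, V W & S = revsg W.

Lemma pv_rev_memE (S : finSemigroupType) : pv_rev_mem S <-> V (revsg S).
Proof.
split=> [[W VW ->]|VS]; first by rewrite revsgK.
by exists (revsg S); rewrite ?revsgK.
Qed.

Fact pv_rev_sub (S : finSemigroupType) (A : subsg S) :
  pv_rev_mem S -> pv_rev_mem (subsg_of A).
Proof.
move=> /pv_rev_memE VS; apply/pv_rev_memE.
have Bc : mulg_closed ((A : {set S}) : {set revsg S}).
  by move=> x y xA yA; exact: (@subsg_closed S A y x yA xA).
pose g (x : subsg_of (Subsg Bc)) : revsg (subsg_of A) := x.
have gM : {morph g : x y / x * y} by move=> x y; apply: val_inj.
pose gm := isMultiplicative.Build _ _ g gM.
pose G : {multiplicative subsg_of (Subsg Bc) -> revsg (subsg_of A)} :=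
  HB.pack g gm.
by apply: (@pv_img V _ _ G _ (pv_sub (Subsg Bc) VS)) => x; exists x.
Qed.

Fact pv_rev_img (S T : finSemigroupType) (f : {multiplicative S -> T}) :
  surj f -> pv_rev_mem S -> pv_rev_mem T.
Proof.
move=> fs /pv_rev_memE VS; apply/pv_rev_memE.
exact: (@pv_img V _ _ (revmor f) fs VS).
Qed.

Fact pv_rev_unit : pv_rev_mem unit.
Proof.
apply/pv_rev_memE; pose g (x : unit) : revsg unit := x.
have gM : {morph g : x y / x * y} by [].
pose gm := isMultiplicative.Build _ _ g gM.
pose G : {multiplicative unit -> revsg unit} := HB.pack g gm.
by apply: (@pv_img V _ _ G _ (pv_unit V)) => x; exists x.
Qed.

Fact pv_rev_prod (S T : finSemigroupType) :
  pv_rev_mem S -> pv_rev_mem T -> pv_rev_mem (S * T)%type.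
Proof.
move=> /pv_rev_memE VS /pv_rev_memE VT; apply/pv_rev_memE.
pose g (x : (revsg S * revsg T)%type) : revsg (S * T)%type := x.
have gM : {morph g : x y / x * y} by [].
pose gm := isMultiplicative.Build _ _ g gM.
pose G : {multiplicative (revsg S * revsg T)%type -> revsg (S * T)%type} :=
  HB.pack g gm.
by apply: (@pv_img V _ _ G _ (pv_prod VS VT)) => x; exists x.
Qed.

Definition pv_rev : pseudovariety :=
  Pseudovariety pv_rev_sub pv_rev_img pv_rev_unit pv_rev_prod.

End PvRev.

(* As S and revsg S share their carrier, so do P(S^rev)^rev and P(S); the      *)
(* reversal of a subsemigroup of P(S^rev) is thus a subsemigroup of P(S) with  *)
(* exactly the same members.                                                   *)
Section RevComplex.
Variables (S : finSemigroupType) (A : subsg (powersg (revsg S))).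

Fact powersg_mul_rev (X Y : powersg (revsg S)) :
  X * Y = (Y : powersg S) * (X : powersg S).
Proof.
apply: val_inj; apply/setP => z; apply/imset2P/imset2P => -[x y xX yY ->].
  by exists y x.
by exists y x.
Qed.

Fact rev_complex_closed : mulg_closed ((A : {set _}) : {set powersg S}).
Proof.
move=> X Y XA YA; rewrite -(powersg_mul_rev Y X); exact: (@subsg_closed _ A Y X YA XA).
Qed.

Definition rev_complex : subsg (powersg S) := Subsg rev_complex_closed.

End RevComplex.

Lemma powersg_map_rev (S T : finSemigroupType) (f : S -> T) (X : powersg S) :
  (powersg_map (S := revsg S) (T := revsg T) (revmor f) X : powersg T) =
  powersg_map f X.
Proof. by apply: val_inj; apply/setP => t; apply/imsetP/imsetP. Qed.

Section CfRev.
Variable C : complex_functor.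

Definition cf_rev_obj (S : finSemigroupType) : subsg (powersg S) :=
  rev_complex (C (revsg S)).

Fact cf_rev_complex S : is_complex (cf_rev_obj S).
Proof.
have [h1 h2] := cf_complex C (revsg S); split; last exact: h2.
apply/subsetP => X /imsetP[x _ ->].
by apply: (subsetP h1); apply/imsetP; exists x; rewrite ?inE //; apply: val_inj.
Qed.

Fact cf_rev_map (S T : finSemigroupType) (f : {multiplicative S -> T})
  (X : powersg S) : X \in cf_rev_obj S -> powersg_map f X \in cf_rev_obj T.
Proof.
by move=> XC; rewrite -powersg_map_rev; exact: (@cf_map C _ _ (revmor f) X XC).
Qed.

Fact cf_rev_surj (S T : finSemigroupType) (f : {multiplicative S -> T}) :
  surj f -> forall Y : powersg T, Y \in cf_rev_obj T ->
  exists2 X : powersg S, X \in cf_rev_obj S & powersg_map f X = Y.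
Proof.
move=> fs Y YC; have [X XC XY] := @cf_surj C _ _ (revmor f) fs Y YC.
by exists X; rewrite // -powersg_map_rev.
Qed.

Definition cf_rev : complex_functor :=
  ComplexFunctor cf_rev_complex cf_rev_map cf_rev_surj.

End CfRev.

Definition cf_algebraic (lambda : complex_functor -> complex_functor) :=
  (forall C D, cf_le C D -> cf_le (lambda C) (lambda D)) /\
  forall C D, (forall S, Fix C S <-> Fix D S) ->
    forall S, Fix (lambda C) S <-> Fix (lambda D) S.

Definition pointlike_transfer (lambda : complex_functor -> complex_functor)
    (alpha : pseudovariety -> pseudovariety) :=
  [/\ cf_algebraic lambda, pv_continuous alpha
    & forall V, lambda (PL V) = PL (alpha V)].

(* Main.v *)
From mathcomp Require Import all_boot.
From mathcomp Require Import boolp.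
Require Import Defs.

(** A relational morphism from [S] to [T] and one from [revsg S] to [revsg T]
are the same data: a subset of [S * T] is closed under the product iff it is
closed under the reversed product, because [T] is reversed together with [S]
([rev_relmor], [unrev_relmor]).  Reversal changes neither the fibres of a
relational morphism nor, therefore, its nerve.  Since [V] consists of the
reversals of the members of [pv_rev V], the pointlikes of [S] for [pv_rev V]
and those of [revsg S] for [V] are intersections of the same family of nerves
([PL_rev_set]).

The other claims follow because reversal is an involution preserving order:
on complex functors it moves the test for [Fix] from [S] to [revsg S]
([Fix_cf_rev]), and on pseudovarieties it is an automorphism of the lattice,
so that it preserves all joins ([pv_rev_join]). *)

Set Implicit Arguments.
Unset Strict Implicit.

Local Open Scope group_scope.

Lemma subsg_eq (S : finSemigroupType) (A B : subsg S) :
  A = B :> {set S} -> A = B.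
Proof.
by case: A B => [A Ac] [B Bc] /= E; subst B; congr Subsg; apply: Prop_irrelevance.
Qed.

Lemma cf_eq (C D : complex_functor) : (forall S, C S = D S) -> C = D.
Proof.
case: C D => [C c1 c2 c3] [D d1 d2 d3] /= E.
have {}E : C = D by apply: functional_extensionality_dep.
by subst D; congr ComplexFunctor; apply: Prop_irrelevance.
Qed.

Lemma pv_eq (V W : pseudovariety) : pv_le V W -> pv_le W V -> V = W.
Proof.
case: V W => [V v1 v2 v3 v4] [W w1 w2 w3 w4] VW WV.
have E : V = W by apply/funext => S; apply/propext; split; [apply: VW|apply: WV].
by subst W; congr Pseudovariety; apply: Prop_irrelevance.
Qed.

Lemma sing_rev (S : finSemigroupType) :
  sing (revsg S) = sing S :> {set powersg S}.
Proof.
by apply/setP => X; apply/imsetP/imsetP => -[x _ ->]; exists x => //; apply: val_inj.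
Qed.

Lemma Fix_cf_rev (C : complex_functor) (S : finSemigroupType) :
  Fix (cf_rev C) S <-> Fix C (revsg S).
Proof.
rewrite /Fix; split=> E; first exact: etrans E (esym (sing_rev S)).
exact: etrans E (sing_rev S).
Qed.

Lemma cf_rev_algebraic : cf_algebraic cf_rev.
Proof.
split=> [C D CD S|C D CD S]; first exact: CD (revsg S).
by rewrite !Fix_cf_rev.
Qed.

Lemma pv_rev_le (V W : pseudovariety) : pv_le V W -> pv_le (pv_rev V) (pv_rev W).
Proof. by move=> VW S [T VT ->]; exists T; first exact: VW. Qed.

Lemma pv_revK (V : pseudovariety) : pv_rev (pv_rev V) = V.
Proof.
by apply: pv_eq => S; rewrite /= !pv_rev_memE /= !pv_rev_memE revsgK.
Qed.

(** The inequality that monotonicity alone does not give becomes such a one after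
[pv_rev] is applied to both sides, [pv_rev] being its own inverse. *)
Lemma pv_rev_join (D : pseudovariety -> Prop) :
  pv_rev (pv_join D) = pv_join (fun W => exists2 V, D V & W = pv_rev V).
Proof.
apply: pv_eq.
  rewrite -[X in pv_le _ X]pv_revK; apply: pv_rev_le; apply: pv_join_lub => V DV.
  rewrite -[V]pv_revK; apply: pv_rev_le; apply: pv_join_ub.
  by exists V.
by apply: pv_join_lub => _ [V DV ->]; apply: pv_rev_le; apply: pv_join_ub.
Qed.

Lemma pv_rev_continuous : pv_continuous pv_rev.
Proof. by split=> [|D _]; [exact: pv_rev_le|exact: pv_rev_join]. Qed.

Lemma rev_relmor (S T : finSemigroupType) (rho : relmor S T) :
  exists sigma : relmor (revsg S) (revsg T),
    forall (s : S) (t : T), ((s, t) \in sigma) = ((s, t) \in rho).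
Proof.
have Gc : mulg_closed ((rho : {set S * T}) : {set revsg S * revsg T}).
  by move=> x y xG yG; exact: (@subsg_closed _ rho y x yG xG).
have Gp (s : revsg S) : exists t : revsg T, (s, t) \in Subsg Gc.
  exact: (graph_proj rho s).
by exists (Relmor Gp).
Qed.

(** Applying [rev_relmor] to [rho] would produce a relational morphism from
[revsg (revsg S)], equal to [S] only propositionally; a direct construction
avoids the transport. *)
Lemma unrev_relmor (S T : finSemigroupType) (rho : relmor (revsg S) T) :
  exists sigma : relmor S (revsg T),
    forall (s : S) (t : T), ((s, t) \in sigma) = ((s, t) \in rho).
Proof.
have Gc : mulg_closed ((rho : {set revsg S * T}) : {set S * revsg T}).
  by move=> x y xG yG; exact: (@subsg_closed _ rho y x yG xG).
have Gp (s : S) : exists t : revsg T, (s, t) \in Subsg Gc.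
  exact: (graph_proj rho s).
by exists (Relmor Gp).
Qed.

Lemma PL_rev_set (V : pseudovariety) (S : finSemigroupType) :
  PL_set (pv_rev V) S = PL_set V (revsg S) :> {set powersg S}.
Proof.
apply/setP => X; apply/(@PL_setP (pv_rev V) S X)/(@PL_setP V (revsg S) X) => hX T rho.
  move=> VT; have [sigma sE] := unrev_relmor rho.
  have VrT : pv_rev V (revsg T) by exists T.
  have /nerveP[t ht] := hX _ sigma VrT.
  by apply/nerveP; exists t => s /ht; rewrite sE.
move=> /pv_rev_memE VT; have [sigma sE] := rev_relmor rho.
have /nerveP[t ht] := hX _ sigma VT.
by apply/nerveP; exists t => s /ht; rewrite sE.
Qed.

Theorem mainTheorem8 :
  pointlike_transfer cf_rev pv_rev /\
  forall (V : pseudovariety) (S : finSemigroupType),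
    PL (pv_rev V) S = rev_complex (PL V (revsg S)).
Proof.
have PL_rev (V : pseudovariety) (S : finSemigroupType) :
    PL (pv_rev V) S = rev_complex (PL V (revsg S)).
  by apply: subsg_eq; apply: PL_rev_set.
split=> //; split.
- exact: cf_rev_algebraic.
- exact: pv_rev_continuous.
by move=> V; apply: cf_eq => S; rewrite PL_rev.
Qed.
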